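(* Every omnitonal graph is bipartite.
   Context: Graphs are finite and simple; $e(G)=|E(G)|$. A $2$-coloring $E(K_n)=E(R)\cup E(B)$ is a partition of the edges of $K_n$ into red edges (forming $R$) and blue edges (forming $B$). An $(r,b)$-colored copy of $G$ (with $r+b=e(G)$) is a (not necessarily induced) subgraph of $K_n$ isomorphic to $G$ with exactly $r$ red and $b$ blue edges. ${\rm ot}(n,G)$ is the minimum non-negative integer $s$ such that every $2$-coloring $E(K_n)=E(R)\cup E(B)$ with $\min\{e(R),e(B)\}>s$ contains an $(r,b)$-colored copy of $G$ for every pair of integers $r,b\ge0$ with $r+b=e(G)$. The graph $G$ is omnitonal if for every sufficiently large $n$ such an integer exists non-vacuously, that is, ${\rm ot}(n,G)<\lfloor\frac12\binom n2\rfloor$ (so that there are colorings with $\min\{e(R),e(B)\}>{\rm ot}(n,G)$). *)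

(* Defs.v *)
From mathcomp Require Import all_boot.
From mathcomp Require Import boolp.

Set Implicit Arguments.
Unset Strict Implicit.
Unset Printing Implicit Defensive.

Record sgraph := SGraph {
  vertex :> finType;
  adj : rel vertex;
  adj_sym : symmetric adj;
  adj_irrefl : irreflexive adj
}.

(* Edges are unordered pairs, hence sets of two vertices. *)
Definition edges (G : sgraph) : {set {set G}} :=
  [set [set x; y] | x in [set: G], y in [set: G] & adj x y].

Definition bipartite (G : sgraph) : Prop :=
  exists A B : {set G},
    [/\ A :|: B = [set: G], [disjoint A & B] &
        forall x y : G, adj x y ->
          (x \in A) && (y \in B) || (x \in B) && (y \in A)].

Definition neq_rel (T : eqType) : rel T := fun x y => x != y.

Lemma neq_rel_sym (T : eqType) : symmetric (@neq_rel T).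
Proof. by move=> x y; rewrite /neq_rel eq_sym. Qed.

Lemma neq_rel_irrefl (T : eqType) : irreflexive (@neq_rel T).
Proof. by move=> x; rewrite /neq_rel eqxx. Qed.

Definition complete (n : nat) : sgraph :=
  @SGraph 'I_n (@neq_rel 'I_n) (@neq_rel_sym 'I_n) (@neq_rel_irrefl 'I_n).

(* Not necessarily induced. *)
Record subgraph (H : sgraph) := Subgraph {
  sub_vertices : {set H};
  sub_edges : {set {set H}};
  sub_edges_sub : sub_edges \subset edges H;
  sub_edges_closed : forall e, e \in sub_edges -> e \subset sub_vertices
}.

Definition isomorphic_to_subgraph (G H : sgraph) (S : subgraph H) : Prop :=
  exists f : G -> H,
    [/\ injective f, f @: [set: G] = sub_vertices S &
        forall x y : G, adj x y = ([set f x; f y] \in sub_edges S)].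

(* Colour classes may be empty, unlike the blocks of finset's [partition]. *)
Definition two_coloring (n : nat) (R B : {set {set complete n}}) : Prop :=
  R :|: B = edges (complete n) /\ [disjoint R & B].

Definition colored_copy (n : nat) (R B : {set {set complete n}})
    (G : sgraph) (r b : nat) : Prop :=
  exists S : subgraph (complete n),
    [/\ isomorphic_to_subgraph G S,
        #|sub_edges S :&: R| = r & #|sub_edges S :&: B| = b].

Definition ot_bound (n : nat) (G : sgraph) (s : nat) : Prop :=
  forall R B : {set {set complete n}},
    two_coloring R B -> s < minn #|R| #|B| ->
    forall r b : nat, r + b = #|edges G| -> colored_copy R B G r b.

(* A large s works vacuously, so the minimum defining ot always exists. *)
Lemma ot_bound_exists (n : nat) (G : sgraph) :
  exists s, `[< ot_bound n G s >].
Proof.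
exists #|{: {set complete n}}|; apply/asboolP => R B _.
by rewrite leq_min leqNgt ltnS max_card.
Qed.

Definition ot (n : nat) (G : sgraph) : nat := ex_minn (ot_bound_exists n G).

Definition omnitonal (G : sgraph) : Prop :=
  exists N : nat, forall n : nat, N <= n -> ot n G < 'C(n, 2)./2.

(* Main.v *)
(** If [n = m^2], the complete bipartite graph with parts of sizes [C(m,2)] and
    [C(m+1,2)] has exactly half of the edges of [K_n].  Colour its edges red and
    the others blue: both colour classes exceed [ot n G], so there is an all-red
    copy of [G], which is a subgraph of a bipartite graph. *)
Require Import Defs.
From mathcomp Require Import all_boot boolp zify.

Set Implicit Arguments.
Unset Strict Implicit.
Unset Printing Implicit Defensive.

Lemma mul_pred_bin2 p : p * p.-1 = 2 * 'C(p, 2).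
Proof. by rewrite -{1}(bin1 p.-1) mul_bin_diag. Qed.

(** Both sides equal $m^2(m-1)(m+1)/2$. So half the edges of $K_{m^2}$ is an integer, with a
    factorization fit to be the edge count of a complete bipartite graph. *)
Lemma bin2_sqr m : 'C(m ^ 2, 2) = ('C(m, 2) * 'C(m.+1, 2)).*2.
Proof.
case: m => [|m]; first by rewrite !bin_small.
have := mul_pred_bin2 (m.+1 ^ 2); have := mul_pred_bin2 m.+1; have := mul_pred_bin2 m.+2.
by rewrite /= expnS expn1; nia.
Qed.

Lemma edges_complete n : edges (complete n) = [set e : {set 'I_n} | #|e| == 2].
Proof.
apply/setP => e; rewrite inE; apply/imset2P/cards2P.
  by case=> x y _; rewrite inE => /andP[_ xy] ->; exists x, y.
by case=> x [y] [xy ->]; exists x y; rewrite ?inE.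
Qed.

Lemma card_edges_complete n : #|edges (complete n)| = 'C(n, 2).
Proof. by rewrite edges_complete card_draws card_ord. Qed.

(** The edge set of the complete bipartite graph with parts [A] and [~: A]. *)
Definition crossing (T : finType) (A : {set T}) : {set {set T}} :=
  [set [set p.1; p.2] | p in setX A (~: A)].

Lemma mem_crossing (T : finType) (A : {set T}) (x y : T) :
  [set x; y] \in crossing A -> (x \in A) != (y \in A).
Proof.
case/imsetP => -[u v] /=; rewrite !inE /= => /andP[uA vA] E.
have : u \in [set x; y] by rewrite E set21.
have : v \in [set x; y] by rewrite E set22.
by rewrite !inE => /orP[]/eqP ? /orP[]/eqP ?; subst; rewrite ?uA ?(negPf vA) //;
  case/negP: vA.
Qed.

(** Exactly one end of a crossing edge lies in [A], so the unordered edge determines the ordered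
    pair. *)
Lemma card_crossing (T : finType) (A : {set T}) :
  #|crossing A| = #|A| * #|~: A|.
Proof.
rewrite card_in_imset ?cardsX // => -[x y] [u v] /=.
rewrite !inE /= => /andP[xA yA] /andP[uA vA] E.
have : x \in [set u; v] by rewrite -E set21.
have : y \in [set u; v] by rewrite -E set22.
by rewrite !inE => /orP[]/eqP ? /orP[]/eqP ?; subst => //;
  by [case/negP: yA | case/negP: vA].
Qed.

Lemma crossing_sub_edges n (A : {set 'I_n}) :
  crossing A \subset edges (complete n).
Proof.
apply/subsetP => _ /imsetP[[x y] /= + ->]; rewrite edges_complete !inE /=.
move=> /andP[xA yA]; rewrite cards2.
by suff -> : x != y by []; apply: contraNneq yA => <-.
Qed.

Lemma two_coloring_crossing n (A : {set 'I_n}) :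
  @two_coloring n (crossing A) (edges (complete n) :\: crossing A).
Proof.
split; first by rewrite -{1}(setIidPr (crossing_sub_edges A)) setID.
by rewrite disjoint_sym -setI_eq0 setIDAC setDIl setDv setI0.
Qed.

(** With no blue edge, every edge of the copy crosses; pulling [A] and its complement back along the
    embedding gives the two parts. *)
Lemma crossing_copy_bipartite n (A : {set 'I_n}) (G : sgraph) r :
  @colored_copy n (crossing A) (edges (complete n) :\: crossing A) G r 0 ->
  bipartite G.
Proof.
case=> S [[f [_ _ fE]] _ /eqP]; rewrite cards_eq0 => /eqP S0.
exists (f @^-1: A), (~: (f @^-1: A)); split; first exact: setUCr.
  by rewrite -setI_eq0 setICr.
move=> x y; rewrite fE => Sxy.
have : [set f x; f y] \in crossing A.
  apply: contraT => ncr; move/setP/(_ [set f x; f y]): S0.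
  by rewrite !inE Sxy ncr (subsetP (sub_edges_sub S) _ Sxy).
by move/mem_crossing; rewrite !inE; do 2!case: (_ \in A).
Qed.

Lemma card_ord_lt n a : a <= n -> #|[set i : 'I_n | i < a]| = a.
Proof.
by move=> an; rewrite cardsE -sum1_card (big_ord_narrow an) sum1_card card_ord.
Qed.

Lemma balanced_crossing m : exists A : {set 'I_(m ^ 2)},
  #|crossing A| = 'C(m ^ 2, 2)./2 /\
  #|edges (complete (m ^ 2)) :\: crossing A| = 'C(m ^ 2, 2)./2.
Proof.
(* Consecutive triangular numbers sum to a square, so the two part sizes use up all the vertices. *)
have split_sqr : 'C(m, 2) + 'C(m.+1, 2) = m ^ 2.
  by have := mul_pred_bin2 m; rewrite binS bin1; nia.
pose A := [set i : 'I_(m ^ 2) | i < 'C(m, 2)].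
have cA : #|A| = 'C(m, 2) by rewrite card_ord_lt // -split_sqr leq_addr.
have cAC : #|~: A| = 'C(m.+1, 2).
  by apply/eqP; rewrite -(eqn_add2l #|A|) cardsC card_ord cA split_sqr.
exists A; rewrite cardsDS ?crossing_sub_edges // card_edges_complete.
(* The total is an exact double, so halving loses nothing and both classes get the same size. *)
by rewrite card_crossing cA cAC bin2_sqr doubleK -addnn addnK.
Qed.

Theorem theorem2p8 (G : sgraph) (hG : omnitonal G) : bipartite G.
Proof.
have [N small_ot] := hG.
(* Since [N <= N ^ 2], the square of the threshold itself is a large enough order. *)
have [A [cR cB]] := balanced_crossing N.
have := small_ot (N ^ 2); rewrite /ot.
case: ex_minnP => s /asboolP s_bound _ s_small.
apply: (@crossing_copy_bipartite _ A G #|edges G|).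
apply: s_bound; rewrite ?addn0 //; first exact: two_coloring_crossing.
by rewrite cR cB minnn s_small //; nia.
Qed.
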